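(* Every commutative von Neumann regular ring $A$ with unit can be expanded to a meadow, i.e. there is a total unary operation ${}^{-1}$ on $A$ such that $(x^{-1})^{-1}=x$ and $x\cdot(x\cdot x^{-1})=x$ for all $x\in A$. Moreover, this expansion is unique: there is only one such operation on $A$.
   Context: A commutative von Neumann regular ring is a commutative ring with unit in which for every $x$ there exists $y$ with $x\cdot y\cdot x=x$. A meadow is a commutative ring with unit (possibly trivial) equipped with a total unary operation ${}^{-1}$ satisfying $(x^{-1})^{-1}=x$ and $x\cdot(x\cdot x^{-1})=x$ for all $x$. *)

(* Defs.v *)
From mathcomp Require Import all_boot all_algebra.

Set Implicit Arguments.
Unset Strict Implicit.
Unset Printing Implicit Defensive.

Import GRing.Theory.
Local Open Scope ring_scope.

(* Rings are taken in comPzRingType, which, unlike comNzRingType, allows the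
   trivial ring. *)

Definition von_neumann_regular (A : comPzRingType) : Prop :=
  forall x : A, exists y : A, x * y * x = x.

(* The total operation is written inv rather than _^-1, since the latter
   belongs to unitRingType, with the convention that a non-unit is its own
   inverse, which is in general not a meadow inverse. *)
Definition meadow_inverse (A : comPzRingType) (inv : A -> A) : Prop :=
  (forall x : A, inv (inv x) = x) /\ (forall x : A, x * (x * inv x) = x).

(* Main.v *)
Require Import Defs.
From mathcomp Require Import all_boot all_algebra.
From Stdlib Require Import FunctionalExtensionality.

Import GRing.Theory.
Local Open Scope ring_scope.

(** In a commutative ring an element [x] has at most one generalized inverse,
    i.e. one [y] with [x * y * x = x] and [y * x * y = y]; and if [y] satisfies
    the first equation then [y * x * y] satisfies both.  The relation is
    symmetric in [x] and [y], so uniqueness makes the resulting operation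
    involutive.  Conversely, the meadow equations at [x] and at [inv x] say
    exactly that [inv x] is a generalized inverse of [x]. *)

Definition ginverse (A : comPzRingType) (x y : A) : Prop :=
  x * y * x = x /\ y * x * y = y.

Lemma ginverse_sym (A : comPzRingType) (x y : A) :
  ginverse A x y -> ginverse A y x.
Proof. by case. Qed.

(** By commutativity [u = u * x * u = u * (x * v * x) * u = (u * x * u) * x * v = u * x * v]; hence
    [y = y * x * z] and [z = z * x * y], the same product. *)
Lemma ginverse_uniq (A : comPzRingType) (x y z : A) :
  ginverse A x y -> ginverse A x z -> y = z.
Proof.
move=> [xyx yxy] [xzx zxz].
have half u v : x * v * x = x -> u * x * u = u -> u = u * x * v.
  move=> xvx uxu; rewrite -{1}uxu -[in LHS]xvx -[in RHS]uxu !mulrA.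
  by rewrite mulrAC (mulrAC _ v u) (mulrAC _ v x).
by rewrite (half y z) // [RHS](half z y) // mulrAC (mulrC y) mulrAC.
Qed.

Lemma ginverse_of_inner (A : comPzRingType) (x y : A) :
  x * y * x = x -> ginverse A x (y * x * y).
Proof.
(* The hypothesis in right-nested form, to cancel inside longer products. *)
move=> xyx; have xyxM z : x * (y * (x * z)) = x * z by rewrite !mulrA xyx.
by split; rewrite -!mulrA !xyxM // mulrA.
Qed.

Lemma ginverse_meadow (A : comPzRingType) (inv : A -> A) (x : A) :
  meadow_inverse inv -> ginverse A x (inv x).
Proof.
move=> [invK mulV]; split; first by rewrite mulrAC -mulrA mulV.
by rewrite mulrAC -mulrA -{3}(invK x) mulV.
Qed.

Theorem lemma2p11 (A : comPzRingType) (hA : von_neumann_regular A) :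
  exists! inv : A -> A, meadow_inverse inv.
Proof.
(* The boolean form lets [xchoose] pick [y] as a function of [x], from the choice structure of
   [A]. *)
have hA' (x : A) : exists y, x * y * x == x.
  by have [y xyx] := hA x; exists y; apply/eqP.
pose inv x := let y := xchoose (hA' x) in y * x * y.
have invP x : ginverse A x (inv x).
  exact/ginverse_of_inner/eqP/(xchooseP (hA' x)).
exists inv; split.
  split=> x; last by rewrite mulrA mulrAC; case: (invP x).
  exact: ginverse_uniq (invP (inv x)) (ginverse_sym _ _ _ (invP x)).
move=> inv' inv'P; apply: functional_extensionality => x.
exact: ginverse_uniq (invP x) (ginverse_meadow _ _ _ inv'P).
Qed.
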